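(* Let $\mathbf{S}$ consist of unary relation symbols $A,B$ and a ternary relation symbol $P$. The Boolean query over $\mathbf{S}$ that is true in an $\mathbf{S}$-instance iff there are elements $a_1,\dots,a_n,b$, for some $n\ge 2$, such that $A(a_1)$, $B(a_n)$, and $P(a_i,b,a_{i+1})$ for all $1\le i<n$, is definable in $(\mathrm{GF},\mathrm{UCQ})$ and is not definable in MDDlog.
   Context: **Queries.** A schema $\mathbf{S}$ is a finite set of relation symbols with arities. An instance $\mathfrak{D}$ over $\mathbf{S}$ is a finite set of facts $R(a_1,\dots,a_n)$, $R\in\mathbf{S}$, with $a_i$ from a fixed countably infinite set of constants; $\mathrm{adom}(\mathfrak{D})$ is the set of constants occurring in $\mathfrak{D}$. An $n$-ary query over $\mathbf{S}$ maps each $\mathbf{S}$-instance $\mathfrak{D}$ to a set $q(\mathfrak{D})\subseteq \mathrm{adom}(\mathfrak{D})^n$ (Boolean if $n=0$; true iff $()\in q(\mathfrak{D})$). A query over $\mathbf{S}$ is definable in a query language if that language contains a query over $\mathbf{S}$ agreeing with it on all $\mathbf{S}$-instances. UCQ is the class of unions of conjunctive queries (without constants; equality allowed). **Ontology-mediated queries.** An ontology language $\mathcal{L}$ is a set of first-order (FO) sentences; an $\mathcal{L}$-ontology $\mathcal{O}$ is a finite set of sentences of $\mathcal{L}$, and $\mathrm{sig}(\mathcal{O})$ is the set of its relation symbols. An ontology-mediated query is a triple $(\mathbf{S},\mathcal{O},q)$ with $\mathbf{S}$ a schema (the data schema), $\mathcal{O}$ an ontology and $q$ a query over $\mathbf{S}\cup\mathrm{sig}(\mathcal{O})$.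 A finite relational structure over a schema is a pair $(\mathrm{dom},\mathfrak{D})$ with $\mathrm{dom}$ a finite non-empty set and $\mathfrak{D}$ an instance over the schema with $\mathrm{adom}(\mathfrak{D})\subseteq\mathrm{dom}$. The triple defines the query over $\mathbf{S}$ that maps $\mathfrak{D}$ to the set of certain answers: all $\mathbf{a}\in\mathrm{adom}(\mathfrak{D})^n$ such that $\mathbf{a}\in q(\mathfrak{D}')$ for every finite relational structure $(\mathrm{dom},\mathfrak{D}')$ over $\mathbf{S}\cup\mathrm{sig}(\mathcal{O})$ that satisfies $\mathcal{O}$ and has $\mathfrak{D}\subseteq\mathfrak{D}'$. $(\mathcal{L},\mathcal{Q})$ denotes the query language of all queries defined by ontology-mediated queries $(\mathbf{S},\mathcal{O},q)$ with $\mathcal{O}$ an $\mathcal{L}$-ontology and $q\in\mathcal{Q}$. **GF.** The guarded fragment GF comprises all formulas built from atomic formulas using the Boolean connectives and guarded quantification $\exists\mathbf{x}(\alpha\wedge\varphi)$ and $\forall\mathbf{x}(\alpha\to\varphi)$, where $\alpha$ is an atomic formula (the guard) containing all free variables of $\varphi$. Equality is not allowed, except that trivial equalities $x=x$ may be used as guards. **MDDlog.** A disjunctive datalog rule has the form $S_1(\mathbf{x}_1)\vee\cdots\vee S_m(\mathbf{x}_m)\leftarrow R_1(\mathbf{y}_1)\wedge\cdots\wedge R_n(\mathbf{y}_n)$, $m\ge 0$, $n>0$, where every head variable occurs in the body (empty head: $\bot$). A disjunctive datalog (DDlog) program $\Pi$ is a finite set of such rules with a selected predicate $\mathsf{goal}$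 that does not occur in rule bodies and occurs in heads only in rules $\mathsf{goal}(\mathbf{x})\leftarrow R_1(\mathbf{x}_1)\wedge\cdots\wedge R_n(\mathbf{x}_n)$. Relation symbols occurring in some rule head are IDB predicates, the others EDB predicates. $\Pi$ defines the query $q_\Pi$ over the schema of its EDB predicates: $q_\Pi(\mathfrak{D})$ is the set of $\mathbf{a}\in\mathrm{adom}(\mathfrak{D})^n$ ($n$ the arity of $\mathsf{goal}$) with $\mathsf{goal}(\mathbf{a})\in\mathfrak{D}'$ for all instances $\mathfrak{D}'\supseteq\mathfrak{D}$ over the IDB and EDB predicates satisfying all rules of $\Pi$. $\Pi$ is an MDDlog program if all IDB predicates except possibly $\mathsf{goal}$ are unary. MDDlog denotes the language of all queries defined by MDDlog programs. *)

(* Defs.v *)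
From Stdlib Require List.
From HB Require Import structures.
From mathcomp Require Import all_boot finmap.

Set Implicit Arguments.
Unset Strict Implicit.
Unset Printing Implicit Defensive.

Local Open Scope fset_scope.

Definition const : countType := nat.
Definition var : countType := nat.

(* The universe of relation symbols has infinitely many symbols of each
   arity; two symbols with the same name but different arities differ. *)
Record relsym := RelSym { rel_name : nat; arity : nat }.

Definition relsym_pair (r : relsym) := (rel_name r, arity r).
Definition pair_relsym (p : nat * nat) := RelSym p.1 p.2.
Lemma relsym_pairK : cancel relsym_pair pair_relsym. Proof. by case. Qed.
HB.instance Definition _ := Countable.copy relsym (can_type relsym_pairK).

Definition schema := {fset relsym}.

(* [atomic T] is the type of expressions R(t_1, ..., t_n) with n the arity of R
   and t_i : T; facts and relational atoms are the cases T = const, T = var. *)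
Definition atomic (T : Type) := {r : relsym & (arity r).-tuple T}.
HB.instance Definition _ (T : countType) :=
  Countable.copy (atomic T)
    {r : relsym & (fun r : relsym => ((arity r).-tuple T : countType)) r}.

Definition mk_atomic (T : Type) (r : relsym) (t : (arity r).-tuple T)
  : atomic T := Tagged (fun r => (arity r).-tuple T) t.
Arguments mk_atomic {T} r t.

Definition symbol (T : Type) (f : atomic T) : relsym := tag f.
Definition args (T : Type) (f : atomic T) : seq T := tagged f.
Definition map_atomic (T U : Type) (h : T -> U) (f : atomic T) : atomic U :=
  mk_atomic (tag f) (map_tuple h (tagged f)).

Notation fact := (atomic const).
Notation atom := (atomic var).

Definition instance := {fset fact}.

Definition adom (D : instance) : {fset const} :=
  [fset c | f in D, c in args f].

Definition over (S : schema) (D : instance) : Prop :=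
  forall f, f \in D -> symbol f \in S.

(* Only the values on S-instances are meaningful. *)
Record query (S : schema) (n : nat) := Query {
  answer :> instance -> n.-tuple const -> Prop;
  answer_adom : forall D a, over S D -> answer D a -> {subset a <= adom D}
}.

Definition agree (S : schema) (n : nat)
    (q1 q2 : instance -> n.-tuple const -> Prop) : Prop :=
  forall D, over S D -> forall a, q1 D a <-> q2 D a.

Definition query_language := forall (S : schema) (n : nat), query S n -> Prop.

Definition definable (Q : query_language) (S : schema) (n : nat)
    (q : query S n) : Prop :=
  exists q' : query S n, Q S n q' /\ agree S q q'.

Definition atom_vars (s : seq atom) : seq var := flatten [seq args f | f <- s].

(* The answer variables are [cq_head]; every other variable is existentially
   quantified. *)
Record cq (n : nat) := CQ {
  cq_head : n.-tuple var;
  cq_atoms : seq atom;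
  cq_eqs : seq (var * var)
}.

Definition cq_vars (n : nat) (q : cq n) : seq var :=
  cq_head q ++ atom_vars (cq_atoms q) ++ unzip1 (cq_eqs q) ++ unzip2 (cq_eqs q).

(* Variables range over the active domain; this matters only for variables
   that occur in no relational atom. *)
Definition cq_answer (n : nat) (q : cq n) (D : instance)
    (a : n.-tuple const) : Prop :=
  exists h : var -> const,
    [/\ forall x, x \in cq_vars q -> h x \in adom D,
        map_tuple h (cq_head q) = a,
        forall f, f \in cq_atoms q -> map_atomic h f \in D
      & forall e, e \in cq_eqs q -> h e.1 = h e.2].

Definition ucq (n : nat) := seq (cq n).

Definition ucq_answer (n : nat) (u : ucq n) (D : instance)
    (a : n.-tuple const) : Prop :=
  exists2 q, List.In q u & cq_answer q D a.

Definition ucq_over (S : schema) (n : nat) (u : ucq n) : Prop :=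
  forall q, List.In q u -> forall f, f \in cq_atoms q -> symbol f \in S.

Definition UCQ : query_language := fun S n q =>
  exists u : ucq n, [/\ u <> [::], ucq_over S u & agree S q (ucq_answer u)].

Inductive formula :=
| Eq of var & var
| Atom of atom
| Neg of formula
| And of formula & formula
| Or of formula & formula
| Imp of formula & formula
| Ex of var & formula
| All of var & formula.

Fixpoint free_vars (phi : formula) : {fset var} :=
  match phi with
  | Eq x y => [fset x; y]
  | Atom f => [fset x in args f]
  | Neg psi => free_vars psi
  | And psi chi | Or psi chi | Imp psi chi => free_vars psi `|` free_vars chi
  | Ex x psi | All x psi => free_vars psi `\ x
  end.

Definition sentence (phi : formula) : Prop := free_vars phi = fset0.

Fixpoint sig (phi : formula) : {fset relsym} :=
  match phi with
  | Eq _ _ => fset0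
  | Atom f => [fset symbol f]
  | Neg psi => sig psi
  | And psi chi | Or psi chi | Imp psi chi => sig psi `|` sig chi
  | Ex _ psi | All _ psi => sig psi
  end.

Definition update (v : var -> const) (x : var) (c : const) : var -> const :=
  fun y => if y == x then c else v y.

Fixpoint sat (dom : {fset const}) (D : instance) (v : var -> const)
    (phi : formula) : Prop :=
  match phi with
  | Eq x y => v x = v y
  | Atom f => map_atomic v f \in D
  | Neg psi => ~ sat dom D v psi
  | And psi chi => sat dom D v psi /\ sat dom D v chi
  | Or psi chi => sat dom D v psi \/ sat dom D v chi
  | Imp psi chi => sat dom D v psi -> sat dom D v chi
  | Ex x psi => exists2 c, c \in dom & sat dom D (update v x c) psi
  | All x psi => forall c, c \in dom -> sat dom D (update v x c) psi
  end.

Inductive guard : formula -> Prop :=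
| guard_atom f : guard (Atom f)
| guard_eq x : guard (Eq x x).

(* The quantified tuple [x :: xs] is non-empty. *)
Inductive guarded : formula -> Prop :=
| guarded_atom f : guarded (Atom f)
| guarded_neg phi : guarded phi -> guarded (Neg phi)
| guarded_and phi psi : guarded phi -> guarded psi -> guarded (And phi psi)
| guarded_or phi psi : guarded phi -> guarded psi -> guarded (Or phi psi)
| guarded_imp phi psi : guarded phi -> guarded psi -> guarded (Imp phi psi)
| guarded_ex x xs alpha phi :
    guard alpha -> guarded phi -> free_vars phi `<=` free_vars alpha ->
    guarded (foldr Ex (And alpha phi) (x :: xs))
| guarded_all x xs alpha phi :
    guard alpha -> guarded phi -> free_vars phi `<=` free_vars alpha ->
    guarded (foldr All (Imp alpha phi) (x :: xs)).

Definition GF (phi : formula) : Prop := sentence phi /\ guarded phi.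

(* Finite sets of formulas are represented by lists. *)
Definition ontology := seq formula.

Definition ontology_sig (O : ontology) : schema :=
  \big[fsetU/fset0]_(phi <- O) sig phi.

(* Finite relational structures; as the constants are infinitely many, taking
   the domain to be a set of constants is no restriction. *)
Definition structure_over (S : schema) (dom : {fset const}) (D : instance)
  : Prop := [/\ dom != fset0, adom D `<=` dom & over S D].

Definition satisfies (dom : {fset const}) (D : instance) (O : ontology) : Prop :=
  forall phi, List.In phi O -> forall v : var -> const, sat dom D v phi.

Definition certain_answer (S : schema) (O : ontology) (n : nat)
    (q : instance -> n.-tuple const -> Prop) (D : instance)
    (a : n.-tuple const) : Prop :=
  {subset a <= adom D} /\
  forall (dom : {fset const}) (D' : instance),
    structure_over (S `|` ontology_sig O) dom D' ->
    satisfies dom D' O -> D `<=` D' -> q D' a.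

Definition OMQ (L : formula -> Prop) (Q : query_language) : query_language :=
  fun S n q =>
  exists (O : ontology) (q' : query (S `|` ontology_sig O) n),
    [/\ forall phi, List.In phi O -> L phi,
        Q _ n q'
      & agree S q (certain_answer S O q')].

(* An empty head stands for falsity. *)
Record rule := Rule { rule_head : seq atom; rule_body : seq atom }.

Definition rule_wf (r : rule) : Prop :=
  rule_body r <> [::] /\ {subset atom_vars (rule_head r) <= atom_vars (rule_body r)}.

Record ddlog (n : nat) := DDlog { rules : seq rule; goal_name : nat }.

Section DDlog.
Variables (n : nat) (Pi : ddlog n).

Definition goal : relsym := RelSym (goal_name Pi) n.

Definition idb : schema :=
  \big[fsetU/fset0]_(r <- rules Pi) [fset symbol f | f in rule_head r].

Definition edb : schema :=
  (\big[fsetU/fset0]_(r <- rules Pi) [fset symbol f | f in rule_body r]) `\` idb.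

Definition ddlog_wf : Prop :=
  forall r, List.In r (rules Pi) ->
    [/\ rule_wf r,
        goal \notin [seq symbol f | f <- rule_body r]
      & goal \in [seq symbol f | f <- rule_head r] -> size (rule_head r) = 1].

Definition rule_holds (D : instance) (r : rule) : Prop :=
  forall h : var -> const,
    (forall f, f \in rule_body r -> map_atomic h f \in D) ->
    exists2 f, f \in rule_head r & map_atomic h f \in D.

Definition ddlog_answer (D : instance) (a : n.-tuple const) : Prop :=
  {subset a <= adom D} /\
  forall D' : instance,
    over (idb `|` edb) D' -> D `<=` D' ->
    (forall r, List.In r (rules Pi) -> rule_holds D' r) ->
    mk_atomic goal a \in D'.

Definition monadic : Prop :=
  forall r, r \in idb -> r <> goal -> arity r = 1.

End DDlog.

Definition MDDlog : query_language := fun S n q =>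
  exists Pi : ddlog n,
    [/\ ddlog_wf Pi, monadic Pi, edb Pi = S & agree S q (ddlog_answer Pi)].

Section PathQuery.
(* Names of the unary symbols A, B and of the ternary symbol P. *)
Variables A B P : nat.

Definition path_schema : schema := [fset RelSym A 1; RelSym B 1; RelSym P 3].

Definition path_answer (D : instance) (_ : 0.-tuple const) : Prop :=
  exists (n : nat) (a : nat -> const) (b : const),
    [/\ 2 <= n,
        mk_atomic (RelSym A 1) [tuple a 1] \in D,
        mk_atomic (RelSym B 1) [tuple a n] \in D
      & forall i, 1 <= i < n ->
          mk_atomic (RelSym P 3) [tuple a i; b; a i.+1] \in D].

Lemma path_answer_adom D t :
  over path_schema D -> path_answer D t -> {subset t <= adom D}.
Proof. by move=> _ _ x; rewrite tuple0. Qed.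

Definition path_query : query path_schema 0 := Query path_answer_adom.

End PathQuery.

(* Main.v *)
(** The GF-ontology propagates a binary predicate [R(b, y)], meaning that [y]
    ends a path of length at least one through [b] that starts in [A]; the query
    asks for [R(b, y)] with [B(y)].

    Against MDDlog, let [D] be a long path [a_0, ..., a_N] through a single [b]
    and let [D'] have the same [a_i] but elements [b_0, ..., b_(N-1)], where
    [b_j] misses exactly the [j]-th edge.  The query holds in [D] and fails in
    [D'].  In a countermodel of the program on [D'], for [N] large, more [b_j]
    than there are atoms in any rule body carry the same unary predicates.
    Giving these predicates to [b] yields a countermodel on [D]: a rule body
    matched in [D] leaves some edge [j] with [b_j] of that colour unused, so
    it also matches in [D'] after replacing [b] by [b_j]. *)

Require Import Defs.
From mathcomp Require Import all_boot finmap.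
From mathcomp Require Import boolp.

Set Implicit Arguments.
Unset Strict Implicit.
Unset Printing Implicit Defensive.

Local Open Scope fset_scope.

(** * Pigeonhole principle and the action of maps on atoms *)

Lemma pigeonhole_fiber (T C : finType) (f : T -> C) (m : nat) :
  m * #|C| < #|T| -> exists c, m < #|[set t | f t == c]|.
Proof.
move=> lt_mT; apply/existsP; apply: contraLR lt_mT.
rewrite negb_exists -leqNgt => /forallP small.
rewrite -sum1_card (partition_big f predT) //=.
rewrite mulnC -sum_nat_const; apply: leq_sum => c _.
by rewrite sum1dep_card leqNgt small.
Qed.

Lemma map_mk_atomic (T U : Type) (h : T -> U) r (t : (arity r).-tuple T) :
  map_atomic h (mk_atomic r t) = mk_atomic r (map_tuple h t).
Proof. by []. Qed.

Lemma map_atomic_comp (T U V : Type) (g : U -> V) (h : T -> U) (f : atomic T) :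
  map_atomic g (map_atomic h f) = map_atomic (g \o h) f.
Proof.
case: f => r t; congr (mk_atomic r _).
by apply: val_inj; rewrite /= -map_comp.
Qed.

(** Repeating one argument makes sense at every arity, so unary IDB facts can be written without
    transporting tuples along [arity r = 1]. *)
Definition const_atomic (T : Type) (r : relsym) (x : T) : atomic T :=
  mk_atomic r (nseq_tuple (arity r) x).

Lemma map_const_atomic (T U : Type) (h : T -> U) r x :
  map_atomic h (const_atomic r x) = const_atomic r (h x).
Proof. by congr (mk_atomic r _); apply: val_inj; rewrite /= map_nseq. Qed.

Lemma unary_atomicP (T : Type) (f : atomic T) :
  arity (symbol f) = 1 ->
  exists2 x, args f = [:: x] & f = const_atomic (symbol f) x.
Proof.
case: f => [[s k] t] /= k1; rewrite /symbol /args /= in k1 *.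
move: t; rewrite k1 => -[[|x [|? ?]] // size1]; exists x => //.
by congr (mk_atomic _ _); apply: val_inj.
Qed.

Lemma mem_adom (D : instance) f c : f \in D -> c \in args f -> c \in adom D.
Proof. by move=> fD cf; apply/imfset2P; exists f => //; exists c. Qed.

(** * Definability in (GF, UCQ) *)

Section Queries.
Variables A B P : nat.

Definition fA T (x : T) : atomic T := mk_atomic (RelSym A 1) [tuple x].
Definition fB T (x : T) : atomic T := mk_atomic (RelSym B 1) [tuple x].
Definition fP T (x z y : T) : atomic T := mk_atomic (RelSym P 3) [tuple x; z; y].
(** Arity 2 keeps this symbol outside the data schema, whatever numbers [A], [B] and [P] are. *)
Definition fR T (z y : T) : atomic T := mk_atomic (RelSym 0 2) [tuple z; y].

Lemma map_fA T U (h : T -> U) x : map_atomic h (fA x) = fA (h x).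
Proof. by congr mk_atomic; apply: val_inj. Qed.
Lemma map_fB T U (h : T -> U) x : map_atomic h (fB x) = fB (h x).
Proof. by congr mk_atomic; apply: val_inj. Qed.
Lemma map_fP T U (h : T -> U) x z y :
  map_atomic h (fP x z y) = fP (h x) (h z) (h y).
Proof. by congr mk_atomic; apply: val_inj. Qed.
Lemma map_fR T U (h : T -> U) z y : map_atomic h (fR z y) = fR (h z) (h y).
Proof. by congr mk_atomic; apply: val_inj. Qed.
Definition map_facts := (map_fA, map_fB, map_fP, map_fR).

Lemma fP_inj T (x z y x' z' y' : T) :
  fP x z y = fP x' z' y' -> [/\ x = x', z = z' & y = y'].
Proof. by move/(congr1 (@args T)) => [-> -> ->]. Qed.

Inductive reach (D : instance) (b : const) : const -> Prop :=
| reach_start x y : fA x \in D -> fP x b y \in D -> reach D b y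
| reach_step x y : reach D b x -> fP x b y \in D -> reach D b y.

Lemma path_answerP D t :
  path_answer A B P D t <-> exists b y, reach D b y /\ fB y \in D.
Proof.
split=> [[n [a [b [n2 Aa Ba Pa]]]]|[b [y [Dby By]]]].
  exists b, (a n); split=> //.
  (* [reach] needs at least one edge and the path is indexed from 1, hence [1 < k]. *)
  have {Ba} : forall k, 1 < k <= n -> reach D b (a k).
    elim=> // k IHk /andP[]; rewrite ltnS => k1 kn.
    have Pk : fP (a k) b (a k.+1) \in D by apply: Pa; rewrite k1.
    move: k1 Pk; rewrite leq_eqVlt => /predU1P[<-|k1]; first exact: reach_start.
    by apply: reach_step; apply: IHk; rewrite k1 ltnW.
  by apply; rewrite n2 leqnn.
suff [n [a [n2 Aa an Pa]]] : exists n a,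
    [/\ 2 <= n, fA (a 1) \in D, a n = y
      & forall i, 1 <= i < n -> fP (a i) b (a i.+1) \in D].
  by exists n, a, b; split=> //; rewrite an.
elim: Dby {By} => [x {}y Ax Pxy|x {}y _ [n [a [n2 Aa an Pa]]] Pxy].
  exists 2, (fun i => if i == 1 then x else y); split=> //.
  by case=> [|[|]].
(* The path is prolonged by [y] at index [n.+1]; only the last edge is new. *)
exists n.+1, (fun i => if i <= n then a i else y); split.
- exact: ltnW.
- by rewrite (ltnW n2).
- by rewrite ltnn.
move=> i /andP[i1]; rewrite ltnS => le_in; rewrite le_in.
case: ltnP => [lt_in|ge_in]; first by apply: Pa; rewrite i1.
by have -> : i = n by [apply/eqP; rewrite eqn_leq le_in]; rewrite an.
Qed.

(** The disjunction merges the two clauses of [reach]. The middle element is an argument of the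
    [P]-atom, which therefore guards all three variables. *)
Definition reach_sentence : formula :=
  All 0 (All 1 (All 2 (Imp (Atom (fP 0 1 2))
    (Imp (Or (Atom (fA 0)) (Atom (fR 1 0))) (Atom (fR 1 2)))))).

Definition reach_ucq : ucq 0 := [:: CQ [tuple] [:: fR 0 1; fB 1] [::]].

Lemma GF_reach_sentence : GF reach_sentence.
Proof.
split.
  apply/fsetP => x; rewrite !inE.
  by case: (x == 0); case: (x == 1); case: (x == 2).
apply: (@guarded_all 0 [:: 1; 2] (Atom (fP 0 1 2))).
- exact: guard_atom.
- by do !constructor.
apply/fsubsetP => x; rewrite !inE.
by case: (x == 0); case: (x == 1); case: (x == 2).
Qed.

Definition reach_schema : schema :=
  path_schema A B P `|` ontology_sig [:: reach_sentence].

Lemma in_reach_schema r :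
  (r \in reach_schema) = (r \in path_schema A B P) || (r == RelSym 0 2).
Proof.
rewrite /reach_schema /ontology_sig big_seq1 !inE /symbol /=.
by case: (_ == _); case: (_ == RelSym P 3); case: (_ == RelSym 0 2); rewrite ?orbT ?orbF.
Qed.

Lemma reach_ucq_adom D t :
  Defs.over reach_schema D -> ucq_answer reach_ucq D t -> {subset t <= adom D}.
Proof. by move=> _ _ x; rewrite tuple0. Qed.

Definition reach_query : query reach_schema 0 := Query reach_ucq_adom.

Lemma reach_ucqP D t :
  ucq_answer reach_ucq D t <-> exists z y, fR z y \in D /\ fB y \in D.
Proof.
split=> [[q [<-|//] [h [_ _ hD _]]]|[z [y [Rzy By]]]].
  exists (h 0), (h 1); rewrite -(map_fR h) -(map_fB h).
  by split; apply: hD; rewrite !inE eqxx ?orbT.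
exists (CQ [tuple] [:: fR 0 1; fB 1] [::]); first by left.
exists (fun x => if x == 0 then z else y); split=> //=.
- move=> x; rewrite /cq_vars /= !inE => /orP[|/orP[|]] /eqP->.
  + by apply: mem_adom Rzy _; rewrite !inE eqxx.
  + by apply: mem_adom By _; rewrite !inE eqxx.
  + by apply: mem_adom By _; rewrite !inE eqxx.
- by rewrite [RHS]tuple0; apply: val_inj.
- by move=> f; rewrite !inE => /orP[] /eqP->; rewrite map_facts.
Qed.

Lemma satisfies_reach dom D :
  satisfies dom D [:: reach_sentence] <->
  forall x z y, x \in dom -> z \in dom -> y \in dom ->
    fP x z y \in D -> fA x \in D \/ fR z x \in D -> fR z y \in D.
Proof.
split=> [satD x z y xD zD yD|closedD phi [<-|//] v x xD z zD y yD].
  have /= := satD _ (or_introl erefl) (fun=> 0) x xD z zD y yD.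
  by rewrite !map_facts.
by rewrite /= !map_facts; apply: closedD.
Qed.

(** The canonical model over [D]: [R] is interpreted by [reach]. The pairs from [adom D] only serve
    to make the comprehension finite. *)
Definition reach_closure (D : instance) : instance :=
  D `|` [fset f in [fset fR z y | z in adom D, y in adom D]
              | `[< exists z y, f = fR z y /\ reach D z y >]].

Lemma fR_reach_closure D z y : Defs.over (path_schema A B P) D ->
  fR z y \in reach_closure D <-> reach D z y.
Proof.
move=> DS; rewrite !inE /=; split=> [/orP[/DS|/andP[_ /asboolP]]|Dzy].
- by rewrite !inE => /orP[/orP[]|] /eqP.
- by move=> [z' [y' [/(congr1 (@args const)) [-> ->]]]].
apply/orP; right; apply/andP; split; last by apply/asboolP; exists z, y.
have [x Pxy] : exists x, fP x z y \in D by case: Dzy => x *; exists x.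
by apply/imfset2P; exists z; [|exists y => //];
  apply: mem_adom Pxy _; rewrite !inE eqxx ?orbT.
Qed.

Lemma mem_reach_closure D f : symbol f <> RelSym 0 2 ->
  (f \in reach_closure D) = (f \in D).
Proof.
move=> fR'; rewrite !inE /=; case: (f \in D) => //=.
by apply/negP => /andP[_ /asboolP[z [y [fE _]]]]; apply: fR'; rewrite fE.
Qed.

Lemma path_query_GF : definable (OMQ GF UCQ) (path_query A B P).
Proof.
exists (path_query A B P); split; last by [].
exists [:: reach_sentence], reach_query; split.
- by move=> phi [<-|//]; apply: GF_reach_sentence.
- exists reach_ucq; split=> // q [<-|//] f; rewrite in_reach_schema !inE.
  by case/orP=> /eqP->; rewrite /symbol /= eqxx ?orbT.
move=> D DS t; split.
  move=> /(path_answerP D t).1 [b [y [Dby By]]]; split; first by move=> x; rewrite tuple0.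
  move=> dom D' [_ domD' _] /satisfies_reach closedD' /fsubsetP DD'.
  apply/reach_ucqP; exists b, y; split; last exact: DD'.
  have {}closedD' x z w : fP x z w \in D ->
      fA x \in D' \/ fR z x \in D' -> fR z w \in D'.
    move=> /DD' Pxw; apply: closedD' (Pxw); apply: (fsubsetP domD');
      by apply: mem_adom Pxw _; rewrite !inE eqxx ?orbT.
  (* Every model of the ontology extending [D] contains [R] for each reached pair, by induction on
     [reach]. *)
  elim: Dby {By} => [x w /DD' Ax /closedD'|x w _ Rx /closedD']; apply;
    by [left|right].
(* Conversely, the certain answer is evaluated in the closure; adding 0 keeps the domain non-empty
   when [D] is empty. *)
case=> _ /(_ (0 |` adom (reach_closure D)) (reach_closure D)) certain.
have [|||z [y [Dzy By]]] := (reach_ucqP _ _).1 (certain _ _ _).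
- split.
  + by apply/fset0Pn; exists 0; rewrite !inE.
  + exact: fsubsetU1.
  + move=> f; rewrite -/reach_schema in_reach_schema.
    rewrite !inE /= => /orP[/DS|/andP[_ /asboolP[z [y [-> _]]]]].
      by rewrite !inE => ->.
    by rewrite /symbol /= eqxx orbT.
- apply/satisfies_reach => x z y _ _ _.
  rewrite !fR_reach_closure // !mem_reach_closure // => Pxy [Ax|Dzx].
    exact: reach_start Pxy.
  exact: reach_step Pxy.
- exact: fsubsetUl.
apply/path_answerP; exists z, y; split; first exact/fR_reach_closure.
by rewrite -(@mem_reach_closure D).
Qed.

(** * The uniform and the gapped chain *)

Section Chains.
Variable N : nat.

(* The path is coded by the even constants 0, ..., 2N, the middle elements by
   odd ones: 1 in the uniform chain, 2j+1 for [b_j] in the gapped chain. *)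
Definition edge (i : nat) (c : const) : fact := fP i.*2 c i.+1.*2.

Definition uniform_chain : instance :=
  [fset fA 0; fB N.*2] `|` [fset edge i 1 | i in iota 0 N].

Definition gapped_chain : instance :=
  [fset fA 0; fB N.*2] `|`
  [fset edge p.1 p.2.*2.+1 |
    p in [seq p <- allpairs pair (iota 0 N) (iota 0 N) | p.1 != p.2]].

Definition replace_middle (j : nat) (c : const) : const :=
  if c == 1 then j.*2.+1 else c.

Lemma uniform_chainP f :
  reflect [\/ f = fA 0, f = fB N.*2 | exists2 i, i < N & f = edge i 1]
          (f \in uniform_chain).
Proof.
rewrite !inE -orbA; apply: (iffP or3P) => -[/eqP|/eqP|].
- by constructor 1.
- by constructor 2.
- by case/imfsetP=> i /=; rewrite mem_iota => iN ->; constructor 3; exists i.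
- by constructor 1.
- by constructor 2.
case=> i iN ->; constructor 3; apply/imfsetP; exists i => //=.
by rewrite mem_iota.
Qed.

Lemma gapped_chainP f :
  reflect [\/ f = fA 0, f = fB N.*2
            | exists i j, [/\ i < N, j < N, i != j & f = edge i j.*2.+1]]
          (f \in gapped_chain).
Proof.
rewrite !inE -orbA; apply: (iffP or3P) => -[/eqP|/eqP|].
- by constructor 1.
- by constructor 2.
- case/imfsetP=> -[i j] /=; rewrite mem_filter /= => /andP[ij].
  case/allpairsP=> -[i' j'] /= [] + + [iE jE] ->; rewrite iE jE in ij *.
  by rewrite !mem_iota => iN jN; constructor 3; exists i', j'.
- by constructor 1.
- by constructor 2.
case=> i [j [iN jN ij ->]]; constructor 3; apply/imfsetP; exists (i, j) => //=.
by rewrite mem_filter /= ij; apply/allpairsP; exists (i, j); rewrite !mem_iota.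
Qed.

Lemma uniform_chain_over : Defs.over (path_schema A B P) uniform_chain.
Proof.
by move=> f /uniform_chainP[->|->|[i _ ->]]; rewrite !inE /symbol /= eqxx ?orbT.
Qed.

Lemma gapped_chain_over : Defs.over (path_schema A B P) gapped_chain.
Proof.
by move=> f /gapped_chainP[->|->|[i [j [_ _ _ ->]]]];
  rewrite !inE /symbol /= eqxx ?orbT.
Qed.

Lemma path_uniform_chain t :
  0 < N -> path_answer A B P uniform_chain t.
Proof.
move=> N0; exists N.+1, (fun i => i.-1.*2), 1; split=> //.
- by apply/uniform_chainP; constructor 1.
- by apply/uniform_chainP; constructor 2.
by case=> // i /= iN; apply/uniform_chainP; constructor 3; exists i.
Qed.

Lemma fA_gapped_chain x : A <> B -> fA x \in gapped_chain -> x = 0.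
Proof.
move=> hAB /gapped_chainP[]; first by move/(congr1 (@args const)) => [].
  by move/(congr1 (@symbol const)) => [].
by case=> ? [? [_ _ _ /(congr1 (@symbol const))]].
Qed.

Lemma fB_gapped_chain x : A <> B -> fB x \in gapped_chain -> x = N.*2.
Proof.
move=> hAB /gapped_chainP[]; last by case=> ? [? [_ _ _ /(congr1 (@symbol const))]].
  by move/(congr1 (@symbol const)) => [/esym].
by move/(congr1 (@args const)) => [].
Qed.

Lemma fP_gapped_chain x b y : fP x b y \in gapped_chain ->
  exists i j, [/\ x = i.*2, b = j.*2.+1, y = i.+1.*2, i != j & j < N].
Proof.
case/gapped_chainP; try by move/(congr1 (@symbol const)).
by move=> [i [j [_ jN ij]]] /(fP_inj (T := const))[-> -> ->]; exists i, j.
Qed.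

(** Through [b_j] the walk from [a_0] never gets beyond [a_j], because leaving [a_j] takes the
    missing edge. As [j < N], the only [B]-element [a_N] is out of reach. *)
Lemma not_path_gapped_chain t : A <> B -> ~ path_answer A B P gapped_chain t.
Proof.
move=> hAB /path_answerP[b [y [reach_y /(fB_gapped_chain hAB) yN]]].
suff [i [j [_ yE ij jN]]] : exists i j,
    [/\ b = j.*2.+1, y = i.*2, i <= j & j < N].
  by move: ij; rewrite -(double_inj (etrans (esym yN) yE)) leqNgt jN.
elim: reach_y {yN} => [x {}y /(fA_gapped_chain hAB) -> | x {}y _ [i [j [-> -> ij _]]]].
  (* The walk starts at 0, so its first edge has index 0 and the gap satisfies [j != 0]. *)
  case/fP_gapped_chain=> i [j [/(@double_inj 0) <- -> -> j0 jN]].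
  by exists 1, j; split=> //; rewrite lt0n eq_sym.
case/fP_gapped_chain=> i' [j' [/double_inj <- [/double_inj <-] -> ij' jN]].
by exists i.+1, j; split=> //; rewrite ltn_neqAle ij'.
Qed.

Lemma replace_middle_even j i : replace_middle j i.*2 = i.*2.
Proof. by rewrite /replace_middle; case: eqP => // /(congr1 odd); rewrite odd_double. Qed.

(** Of all edges, [b_j] lacks only the [j]-th, so this edge alone prevents [replace_middle j] from
    being a homomorphism. *)
Lemma replace_middle_uniform_chain j f :
  j < N -> f \in uniform_chain -> f != edge j 1 ->
  map_atomic (replace_middle j) f \in gapped_chain.
Proof.
move=> jN /uniform_chainP[->|->|[i iN ->]] fj; apply/gapped_chainP.
- by constructor 1; rewrite map_fA.
- by constructor 2; rewrite map_fB replace_middle_even.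
constructor 3; exists i, j; split=> //; last by rewrite map_fP !replace_middle_even.
by apply: contraNneq fj => ->.
Qed.

(** * Transfer of a countermodel from the gapped to the uniform chain *)

Section Countermodel.
Variables (Pi : ddlog 0) (D'' : instance) (J : {set 'I_N}) (j0 : nat).
Hypothesis wfPi : ddlog_wf Pi.
Hypothesis monPi : monadic Pi.
Hypothesis edbPi : edb Pi = path_schema A B P.
Hypothesis gappedD'' : gapped_chain `<=` D''.
Hypothesis modelD'' : forall r, List.In r (rules Pi) -> rule_holds D'' r.
Hypothesis goalD'' : forall t, mk_atomic (goal Pi) t \notin D''.
Hypothesis bodyJ : forall r, List.In r (rules Pi) -> size (rule_body r) < #|J|.
Hypothesis colourJ : forall (j : 'I_N) r, j \in J -> r \in idb Pi ->
  (const_atomic r j.*2.+1 \in D'') = (const_atomic r j0.*2.+1 \in D'').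

(** [J] indexes middles of equal colour and [j0] supplies that colour: the middle 1 gets the IDB
    predicates of [b_j0], while path elements keep those they have in [D'']. *)
Definition merged_model : instance :=
  uniform_chain `|`
  [fset f in [fset const_atomic r c | r in idb Pi, c in adom uniform_chain]
     | map_atomic (replace_middle j0) f \in D''].

Lemma merged_modelP f :
  reflect (f \in uniform_chain \/
           exists r c, [/\ r \in idb Pi, c \in adom uniform_chain,
             f = const_atomic r c & const_atomic r (replace_middle j0 c) \in D''])
          (f \in merged_model).
Proof.
rewrite [f \in merged_model]in_fsetU; apply: (iffP orP) => -[]; try by left.
  rewrite !inE /= => /andP[/imfset2P[r rPi [c cD ->]]].
  by rewrite map_const_atomic; right; exists r, c.
case=> r [c [rPi cD -> fD]]; right; rewrite !inE /= map_const_atomic fD andbT.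
by apply/imfset2P; exists r => //; exists c.
Qed.

Lemma merged_model_over : Defs.over (idb Pi `|` edb Pi) merged_model.
Proof.
move=> f /merged_modelP[/uniform_chain_over fS|[r [c [rPi _ -> _]]]].
  by apply/fsetUP; right; rewrite edbPi.
by apply/fsetUP; left.
Qed.

Lemma merged_model_adom f c :
  f \in merged_model -> c \in args f -> c \in adom uniform_chain.
Proof.
case/merged_modelP=> [fD|[r [c' [_ c'D -> _]]]]; first exact: mem_adom.
by rewrite /args /= mem_nseq => /andP[_ /eqP->].
Qed.

(** [goal] is nullary, hence not in the data schema, and an added [goal] fact would already lie in
    [D'']. *)
Lemma goal_merged_model t : mk_atomic (goal Pi) t \notin merged_model.
Proof.
apply/negP => /merged_modelP[/uniform_chain_over|[r [c [_ _]]]].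
  by rewrite !inE => /orP[/orP[]|] /eqP.
move=> gE; rewrite -map_const_atomic -gE map_mk_atomic; exact/negP/goalD''.
Qed.

Lemma replace_middle_colour (j : 'I_N) r c : j \in J -> r \in idb Pi ->
  (const_atomic r (replace_middle j c) \in D'')
  = (const_atomic r (replace_middle j0 c) \in D'').
Proof. by move=> jJ rPi; rewrite /replace_middle; case: eqP => // _; apply: colourJ. Qed.

(** Distinct indices give distinct edges, so a list shorter than [#|J|] cannot contain them all. *)
Lemma unused_edge (s : seq fact) :
  size s < #|J| -> exists2 j : 'I_N, j \in J & edge j 1 \notin s.
Proof.
move=> sJ; apply/exists_inP; apply: contraLR sJ.
rewrite negb_exists_in -leqNgt => /forall_inP inJ.
rewrite cardE -(size_map (fun j : 'I_N => edge j 1)); apply: uniq_leq_size.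
  rewrite map_inj_uniq ?enum_uniq // => i j /(fP_inj (T := const))[/double_inj ij _ _].
  exact: val_inj.
by move=> _ /mapP[j + ->]; rewrite mem_enum => /inJ; rewrite negbK.
Qed.

Lemma merged_model_holds r : List.In r (rules Pi) -> rule_holds merged_model r.
Proof.
move=> rPi h bodyE; have [[_ headbody] _ _] := wfPi rPi.
(* The index [j] depends on the match [h]; redirecting 1 to [b_j] then sends the matched body into
   [D'']. *)
have [|j jJ jfree] := @unused_edge (map (map_atomic h) (rule_body r)).
  by rewrite size_map; apply: bodyJ.
have [f|f fhead fD] := modelD'' rPi (h := replace_middle j \o h).
  move=> fbody; rewrite -map_atomic_comp.
  have /merged_modelP[fD|[s [c [sPi _ -> fD]]]] := bodyE _ fbody.
    apply: (fsubsetP gappedD''); apply: replace_middle_uniform_chain => //.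
    by apply: contraNneq jfree => <-; apply: map_f.
  by rewrite map_const_atomic replace_middle_colour.
exists f => //.
have sPi : symbol f \in idb Pi.
  rewrite /idb; elim: (rules Pi) rPi => //= r' rs IH rPi.
  rewrite big_cons in_fsetU; case: rPi => [->|/IH->]; last by rewrite orbT.
  by apply/orP; left; apply/imfsetP; exists f.
(* [D''] has no [goal] fact, so the head atom obtained is not [goal] and monadicity makes it
   unary. *)
have sgoal : symbol f <> goal Pi.
  move: fD; case: (f) => s t; rewrite /symbol /= => + sE.
  by move: t; rewrite sE => t; apply/negP/goalD''.
have [x fx fE] := unary_atomicP (monPi sPi sgoal).
have hx : h x \in adom uniform_chain.
  have /flattenP[_ /mapP[g gbody ->] xg] : x \in atom_vars (rule_body r).
    by apply: headbody; apply/flattenP; exists (args f);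
      [apply: map_f|rewrite fx inE].
  by apply: (merged_model_adom (bodyE _ gbody)); apply: map_f.
apply/merged_modelP; right; exists (symbol f), (h x); split=> //.
  by rewrite {1}fE map_const_atomic.
(* Equal colours bring the head fact back from [b_j] to [b_j0], as the merged model requires. *)
by rewrite -(replace_middle_colour _ jJ sPi) -[replace_middle j _]/((_ \o h) x)
  -map_const_atomic -fE.
Qed.

End Countermodel.
End Chains.

(** * Undefinability in MDDlog *)

Lemma path_query_not_MDDlog : A <> B -> ~ definable MDDlog (path_query A B P).
Proof.
move=> hAB [q [[Pi [wfPi monPi edbPi agree_q]] agree_path]].
have PiP D : Defs.over (path_schema A B P) D ->
    path_answer A B P D [tuple] <-> ddlog_answer Pi D [tuple].
  by move=> DS; apply: iff_trans (agree_path D DS _) (agree_q D DS _).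
pose m := \max_(r <- rules Pi) size (rule_body r).
have bodym r : List.In r (rules Pi) -> size (rule_body r) <= m.
  rewrite /m; elim: (rules Pi) => //= r' rs IH; rewrite big_cons leq_max.
  by case=> [->|/IH->]; rewrite ?leqnn ?orbT.
(* A colour records which IDB predicates hold at a middle. With [N] above [m * #|C|], some colour is
   shared by more than [m] middles, hence by more than any body has atoms. *)
pose C : finType := {ffun idb Pi -> bool}.
pose N := (m * #|C|).+1.
apply: (not_path_gapped_chain (N := N) (t := [tuple]) hAB).
apply/(PiP _ (@gapped_chain_over N)); split=> [x|D'' _ subD'' modelD''].
  by [].
apply: contraT => goalD''.
pose colour (j : 'I_N) : C :=
  [ffun r : idb Pi => const_atomic (val r) (j.*2.+1 : const) \in D''].
have [|c mJ] := @pigeonhole_fiber _ _ colour m; first by rewrite card_ord.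
have [j0 j0J] : exists j0, j0 \in [set j | colour j == c].
  by apply/set0Pn; rewrite -card_gt0; apply: leq_ltn_trans mJ.
have goalD t : mk_atomic (goal Pi) t \notin D''.
  by rewrite (tuple0 t).
have colourJ (j : 'I_N) r : j \in [set j | colour j == c] -> r \in idb Pi ->
  (const_atomic r (j.*2.+1 : const) \in D'')
  = (const_atomic r (j0.*2.+1 : const) \in D'').
  move: j0J; rewrite !inE => /eqP j0c /eqP jc rPi.
  by move: j0c; rewrite -jc => /ffunP /(_ [` rPi]); rewrite !ffunE.
(* The query holds in the uniform chain, so the merged model would have to contain [goal]. *)
have [_ /(_ (merged_model N Pi D'' j0))] :=
  (PiP _ (@uniform_chain_over N)).1 (path_uniform_chain _ (ltn0Sn _)).
have /negP noGoal := goal_merged_model N j0 goalD [tuple].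
case/(_ _ _ _)/noGoal.
- exact: merged_model_over edbPi.
- exact: fsubsetUl.
move=> r rPi; apply: (merged_model_holds (J := [set j | colour j == c])) => //.
by move=> r' /bodym/leq_ltn_trans; apply.
Qed.

End Queries.

Theorem proposition1 (A B P : nat) (hAB : A <> B) :
  definable (OMQ GF UCQ) (path_query A B P) /\
  ~ definable MDDlog (path_query A B P).
Proof. by split; [apply: path_query_GF | apply: path_query_not_MDDlog]. Qed.
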